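(* Let $G$ be a $\Delta$-pure Garside group of finite type. If $g\in G$ is a Morse element, then the action of $g$ on the additional length graph $\mathcal C_{\rm AL}(G)$ is loxodromic and weakly properly discontinuous. In particular, if $G$ contains a Morse element then $\mathcal C_{\rm AL}(G)$ has infinite diameter.
   Context: **Garside groups.** A group $G$ is a Garside group with Garside structure $(G^+,\Delta)$ if $G^+\subset G$ is a submonoid with $G^+\cap (G^+)^{-1}=\{1\}$ and $\Delta\in G^+$ is such that: (1) the partial orders $x\preccurlyeq y\iff x^{-1}y\in G^+$ ($x$ is a prefix of $y$) and $x\succcurlyeq y\iff xy^{-1}\in G^+$ ($y$ is a suffix of $x$) are lattice orders on $G$; (2) $\mathcal D=\{x\in G^+: x\preccurlyeq\Delta\}=\{x\in G^+:\Delta\succcurlyeq x\}$ generates $G^+$ as a monoid and $G$ as a group; (3) for each $x\in G^+\setminus\{1\}$ the number $\sup\{k : x=a_1\cdots a_k,\ a_i\in G^+\setminus\{1\}\}$ is finite. $G$ is of finite type if $\mathcal D$ is finite; then $\tau(g)=\Delta^{-1}g\Delta$ has finite order, denoted $e$. $G$ is $\Delta$-pure if $G^+$ is indecomposable as a Zappa–Szép product, i.e. there are no nontrivial submonoids $A,B\subset G^+$ such that every $m\in G^+$ can be written as $m=ab=b'a'$ with unique $a,a'\in A$ and unique $b,b'\in B$; in a $\Delta$-pure Garside group of finite type, $Z(G)=\langle\Delta^e\rangle$. For $g\in G$: $\inf(g)=\max\{r\in\mathbb Z:\Delta^r\preccurlyeq g\}$, $\sup(g)=\min\{s\in\mathbb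 Z: g\preccurlyeq\Delta^s\}$, and $\underline g=g\Delta^{-\inf(g)}$ (depends only on $g\langle\Delta\rangle$). **Graph $\mathcal X$.** Vertices are the left cosets $g\langle\Delta\rangle$; $g\langle\Delta\rangle$ and $h\langle\Delta\rangle$ are joined by an edge iff $\underline gs\in h\langle\Delta\rangle$ for some $s\in\mathcal D\setminus\{1,\Delta\}$. **Morse elements.** A map $\gamma:\mathbb Z\to X$ to a metric space is Morse if it is a quasi-isometric embedding and for all $\Lambda\ge1,K\ge0$ there is $M^{(\Lambda,K)}$ such that every $(\Lambda,K)$-quasi-geodesic in $X$ connecting two points of $\gamma(\mathbb Z)$ stays in the $M^{(\Lambda,K)}$-neighbourhood of $\gamma(\mathbb Z)$. An element $g\in G$ is Morse if $k\mapsto g^k\langle\Delta\rangle$ is Morse in $\mathcal X$ (with graph metric); equivalently, if $k\mapsto g^kZ(G)$ is Morse in the Cayley graph of $G/Z(G)$ with respect to the image of $\mathcal D$. **Additional length graph.** An element $h\in G$ is absorbable if ($\inf(h)=0$ or $\sup(h)=0$) and there is $g\in G$ with $\inf(g)=\inf(gh)$ and $\sup(g)=\sup(gh)$. The graph $\mathcal C_{\rm AL}(G)$ has the same vertices and edges as $\mathcal X$, plus an additional edge between $g\langle\Delta\rangle$ and $h\langle\Delta\rangle$ whenever there is an absorbable $s\in G$ with $\underline gs\in h\langle\Delta\rangle$. Its graph metric is $d_{\rm AL}$; write $d_{\rm AL}(g,h)=d_{\rm AL}(g\langle\Delta\rangle,h\langle\Delta\rangle)$. The groups $G$ and $G/Z(G)$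 act on $\mathcal C_{\rm AL}(G)$ (a Gromov-hyperbolic graph) by left translation. The action of $g$ is loxodromic if $k\mapsto g^k\langle\Delta\rangle$ is a quasi-isometric embedding $\mathbb Z\to\mathcal C_{\rm AL}(G)$. **WPD.** The action of $g$ on $\mathcal C_{\rm AL}(G)$ is weakly properly discontinuous if for every $k\in G$ and every $\kappa>0$ there exists $N>0$ such that for all $n\ge N$ the set $\{h\in G/Z(G): d_{\rm AL}(k,hk)\le\kappa,\ d_{\rm AL}(g^nk,hg^nk)\le\kappa\}$ is finite. *)

(* Defs.v *)
From mathcomp Require Import all_boot all_order all_algebra.
From mathcomp Require Import classical_sets cardinality reals ereal.

Set Implicit Arguments.
Unset Strict Implicit.
Unset Printing Implicit Defensive.

Import Order.TTheory GRing.Theory Num.Theory.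

Local Open Scope classical_set_scope.
Local Open Scope group_scope.

Section Groups.
Variable G : groupType.
Implicit Types (x y g : G) (A B H M : set G).

Definition expgz x (k : int) : G :=
  match k with Posz n => x ^+ n | Negz n => x ^- n.+1 end.

Definition submonoid M : Prop :=
  M 1 /\ (forall x y, M x -> M y -> M (x * y)).

Definition subgroup H : Prop :=
  submonoid H /\ (forall x, H x -> H x^-1).

Definition center : set G := [set z | forall x, z * x = x * z].

Definition cyclic_subgroup x : set G := range (expgz x).

Definition left_coset H g : set G := [set g * h | h in H].

Definition cosets H : Type := set_type (range (left_coset H)).

Definition coset_class H g : cosets H :=
  exist _ (left_coset H g) (mem_set (imageT (left_coset H) g)).

Record lattice_order (le : G -> G -> Prop) : Prop := LatticeOrder {
  lo_refl : forall x, le x x;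
  lo_antisym : forall x y, le x y -> le y x -> x = y;
  lo_trans : forall x y z, le x y -> le y z -> le x z;
  lo_meet : forall x y, exists m,
    [/\ le m x, le m y & forall z, le z x -> le z y -> le z m];
  lo_join : forall x y, exists j,
    [/\ le x j, le y j & forall z, le x z -> le y z -> le j z] }.

End Groups.

(* Distances are valued in [\bar R] because [graph_dist] below is [+oo] between
   vertices not joined by a path; this does not happen in the two graphs of a
   Garside group, which are connected since the simple elements generate G. *)

Section Coarse.
Variables (R : realType) (X : Type) (d : X -> X -> \bar R).

Definition qi_bounds (L K r : R) (D : \bar R) : Prop :=
  ((r / L - K)%R%:E <= D)%E /\ (D <= (L * r + K)%R%:E)%E.

Definition qi_embedding (gamma : int -> X) : Prop :=
  exists L K : R, [/\ (1 <= L)%R, (0 <= K)%R &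
    forall i j : int, qi_bounds L K `|i - j|%R%:~R (d (gamma i) (gamma j))].

(* [f] matters only on the compact interval [a, b]; it need not be
   continuous. *)
Definition quasi_geodesic (L K a b : R) (f : R -> X) : Prop :=
  (a <= b)%R /\
  forall s t : R, (a <= s <= b)%R -> (a <= t <= b)%R ->
    qi_bounds L K `|s - t|%R (d (f s) (f t)).

Definition morse (gamma : int -> X) : Prop :=
  qi_embedding gamma /\
  forall L K : R, (1 <= L)%R -> (0 <= K)%R ->
    exists M : R, forall (a b : R) (f : R -> X),
      quasi_geodesic L K a b f ->
      range gamma (f a) -> range gamma (f b) ->
      forall t : R, (a <= t <= b)%R ->
        exists k : int, (d (f t) (gamma k) <= M%:E)%E.

Definition diameter : \bar R :=
  ereal_sup (range (fun p : X * X => d p.1 p.2)).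

End Coarse.

Section GraphDistance.
Variables (X : Type) (edge : X -> X -> Prop).

(* Edges are unoriented: they may be traversed in both directions. *)
Fixpoint walk (n : nat) (u v : X) : Prop :=
  match n with
  | 0 => u = v
  | n'.+1 => exists w, (edge u w \/ edge w u) /\ walk n' w v
  end.

Definition graph_dist (R : realType) (u v : X) : \bar R :=
  ereal_inf [set n%:R%:E | n in [set n | walk n u v]].

End GraphDistance.

Section Garside.
Variables (G : groupType) (Gp : set G) (Delta : G).
Implicit Types (x y g h s : G).

Definition prefix_le x y : Prop := Gp (x^-1 * y).

(* [suffix_ge x y]: y is a suffix of x. *)
Definition suffix_ge x y : Prop := Gp (x * y^-1).

Definition simples : set G := [set x | Gp x /\ prefix_le x Delta].

Record garside : Prop := Garside {
  garside_submonoid : submonoid Gp;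
  garside_antisym : forall x, Gp x -> Gp x^-1 -> x = 1;
  garside_Delta : Gp Delta;
  garside_prefix : lattice_order prefix_le;
  garside_suffix : lattice_order suffix_ge;
  garside_balanced : simples = [set x | Gp x /\ suffix_ge Delta x];
  garside_gen_monoid : smallest (@submonoid G) simples = Gp;
  garside_gen_group : smallest (@subgroup G) simples = setT;
  garside_noetherian : forall x, Gp x -> x <> 1 ->
    exists N : nat, forall a : seq G,
      (forall y, y \in a -> Gp y /\ y <> 1) ->
      \prod_(y <- a) y = x -> (size a <= N)%N }.

Definition finite_type : Prop := finite_set simples.

Definition zappa_szep (A B : set G) : Prop :=
  forall m, Gp m ->
    (exists! p : G * G, [/\ A p.1, B p.2 & m = p.1 * p.2]) /\
    (exists! p : G * G, [/\ B p.1, A p.2 & m = p.1 * p.2]).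

Definition Delta_pure : Prop :=
  ~ exists A B : set G,
      [/\ submonoid A /\ A `<=` Gp, submonoid B /\ B `<=` Gp,
          A <> [set 1], B <> [set 1] & zappa_szep A B].

(* The maximum and the minimum exist in every Garside group with
   [Delta <> 1], that is, unless G is trivial. *)
Definition ginf g : int :=
  let S := [set r : int | prefix_le (expgz Delta r) g] in
  xget 0%R (S `&` ubound S).

Definition gsup g : int :=
  let S := [set r : int | prefix_le g (expgz Delta r)] in
  xget 0%R (S `&` lbound S).

(* The representative of the coset of [g] whose infimum is 0. *)
Definition underl g : G := g * expgz Delta (- ginf g)%R.

Definition vertex : Type := cosets (cyclic_subgroup Delta).

Definition vert g : vertex := coset_class (cyclic_subgroup Delta) g.

(* [sval v] is the coset [v] as a subset of G. *)
Definition edge_X (u v : vertex) : Prop :=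
  exists g s, [/\ u = vert g, simples s, s <> 1, s <> Delta &
                  sval v (underl g * s)].

Definition absorbable h : Prop :=
  (ginf h = 0%R \/ gsup h = 0%R) /\
  exists g, ginf g = ginf (g * h) /\ gsup g = gsup (g * h).

Definition edge_AL (u v : vertex) : Prop :=
  edge_X u v \/
  exists g s, [/\ u = vert g, absorbable s & sval v (underl g * s)].

Variable R : realType.

Definition dist_X : vertex -> vertex -> \bar R := @graph_dist vertex edge_X R.

Definition dist_AL : vertex -> vertex -> \bar R := @graph_dist vertex edge_AL R.

Definition morse_element g : Prop :=
  morse dist_X (fun k : int => vert (expgz g k)).

Definition loxodromic g : Prop :=
  qi_embedding dist_AL (fun k : int => vert (expgz g k)).

(* A class in G/Z(G) satisfies the two bounds when one of its representatives
   [h] does; if the centre is generated by a power of [Delta], it fixes every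
   vertex, so the choice of the representative does not matter. *)
Definition wpd g : Prop :=
  forall (k : G) (kappa : R), (0 < kappa)%R ->
    exists N : nat, (0 < N)%N /\
      forall n : nat, (N <= n)%N ->
        finite_set [set coset_class (@center G) h | h in
          [set h | (dist_AL (vert k) (vert (h * k)) <= kappa%:E)%E /\
                   (dist_AL (vert (g ^+ n * k)) (vert (h * (g ^+ n * k)))
                      <= kappa%:E)%E]].

End Garside.

(* Main.v *)
Require Import Defs.
From mathcomp Require Import all_boot all_order all_algebra.
From mathcomp Require Import classical_sets cardinality reals ereal.
From mathcomp Require Import boolp zify lra.

Set Implicit Arguments.
Unset Strict Implicit.
Unset Printing Implicit Defensive.

Import Order.TTheory GRing.Theory Num.Theory.

(** Let d(x, y) = sup(x^-1 y) - inf(x^-1 y): this pseudo-distance on G is the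
    graph distance of X between the cosets of x and y.  A ball of radius r
    about the coset of p consists, in G, of the lattice intervals
    [p Delta^k, p Delta^(k+r)], k an integer.  The prefixes
    x (h /\ Delta^i) that lead from x to y, where h is the representative of
    x^-1 y with infimum 0, form a geodesic of X; they are meets of right
    translates of x and y by powers of Delta, so they never leave a ball that
    contains x and y ([garside_path]).  Convexity of balls and the Morse
    property for a single choice of constants carry the whole coarse argument.

    Let gamma be the axis of a Morse element, q a point and x a point of
    gamma nearest to q.  A convex geodesic from q to another point z of gamma
    must pass near x ([geodesic_near_projection]): otherwise one could leave
    gamma at x in the direction of q, travel inside a ball about q that stays
    away from gamma, and come back to z along the geodesic; this detour would
    be a quasi-geodesic that goes too far from gamma.  Hence nearest-point
    projection to gamma is strongly contracting ([strongly_contracting]), and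
    a geodesic whose ends have distant projections runs close to gamma between
    these projections ([four_point], [path_near_axis]).

    If a absorbs h, with inf(h) = 0, then a, a h and all a h1 with h1 a prefix
    of h have the same infimum and supremum.  So the convex geodesic from u to
    u h lies on a sphere about u a^-1 ([absorbable_sphere]).  A sphere can
    follow gamma only near two places, one on each side of the projection of
    its centre, so u and u h have close projections ([sphere_projection]).
    Projection to gamma is therefore Lipschitz for the additional length
    distance ([nearest_walk_AL]), while the powers of g are their own
    projections: g acts loxodromically and the graph has infinite diameter.

    For weak proper discontinuity, let h move k and g^n k by at most kappa in
    the additional length graph.  Then the projections of h k and h g^n k stay
    near those of k and g^n k, which are far apart for large n, and strong
    contraction bounds the distance from h k to gamma by d(k, g^n k), hence
    also d(k, h k) ([coarse_wpd]).  Since intervals are finite and some power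
    of Delta is central, finitely many classes of h modulo the centre remain
    ([finite_moving_little]). *)

(** * Integer sequences and finite sets *)

Lemma discrete_ivt (f : nat -> nat) (n c s : nat) :
  f 0 <= c -> c <= f n ->
  (forall j, j < n -> f j.+1 <= f j + s) ->
  exists j, [/\ j <= n, c <= f j & f j <= c + s].
Proof.
elim: n => [|n IHn] f0 cn fS; first by exists 0; split=> //; lia.
have [cn'|nc] := leqP c (f n).
  have [j [jn cj jc]] := IHn f0 cn' (fun j jn => fS j (ltnW jn)).
  by exists j; split=> //; lia.
by exists n.+1; split=> //; have := fS n (ltnSn n); lia.
Qed.

Section IntegersAndFiniteSets.
Local Open Scope classical_set_scope.

Lemma int_max (S : set int) : (exists k, S k) -> (exists l, ubound S l) ->
  exists m, S m /\ ubound S m.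
Proof.
move=> [k Sk] [l Sl].
have ex : exists n : nat, `[< S (l - n%:Z)%R >].
  exists `|l - k|%N; apply/asboolP.
  by have := Sl _ Sk; move=> kl; have -> : (l - `|l - k|%N%:Z)%R = k by lia.
case: (ex_minnP ex) => m /asboolP Sm min_m.
exists (l - m%:Z)%R; split=> // r Sr; have rl := Sl _ Sr.
have /min_m : `[< S (l - `|l - r|%N%:Z)%R >].
  by apply/asboolP; have -> : (l - `|l - r|%N%:Z)%R = r by lia.
lia.
Qed.

Lemma finite_set_repetition (T : eqType) (A : set T) (f : nat -> T) :
  finite_set A -> (forall n, A (f n)) -> exists i j, (i < j)%N /\ f i = f j.
Proof.
move=> /finite_seqP[s sA] fA; apply: contrapT => norep.
have fs n : f n \in s by have := fA n; rewrite sA.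
have uniq_f : uniq (map f (iota 0 (size s).+1)).
  rewrite map_inj_uniq ?iota_uniq // => i j fij; apply/eqP.
  case: (ltngtP i j) => // [ij|ji]; case: norep; first by exists i, j.
  by exists j, i.
have /(uniq_leq_size uniq_f) : {subset map f (iota 0 (size s).+1) <= s}.
  by move=> _ /mapP[n _ ->].
by rewrite size_map size_iota ltnn.
Qed.

End IntegersAndFiniteSets.

(** * Integer powers, cosets and the centre *)

Section GroupPreliminaries.
Local Open Scope group_scope.
Variable G : groupType.
Implicit Types (x y z : G) (i j k l : int).

Lemma expgzN_nat x (n : nat) : expgz x (- n%:Z)%R = x ^- n.
Proof. by case: n => [|n] //=; rewrite invg1. Qed.

Lemma expgzD1 x i : expgz x (i + 1)%R = expgz x i * x.
Proof.
case: i => n; first by rewrite -PoszD addn1 /= expgSr.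
have -> : (Negz n + 1 = - n%:Z)%R by lia.
by rewrite expgzN_nat [expgz _ _]/= expgS invgM mulgVK.
Qed.

Lemma expgzB1 x i : expgz x (i - 1)%R = expgz x i * x^-1.
Proof. by rewrite -{2}(subrK 1%R i) expgzD1 mulgK. Qed.

Lemma expgzD x i j : expgz x (i + j)%R = expgz x i * expgz x j.
Proof.
elim: j => [|n IHn|n IHn]; first by rewrite addr0 mulg1.
  by rewrite -addn1 PoszD addrA !expgzD1 IHn mulgA.
have -> : (- n.+1%:Z = - n%:Z - 1)%R by lia.
by rewrite addrA !expgzB1 IHn mulgA.
Qed.

Lemma expgzV x i : (expgz x i)^-1 = expgz x (- i)%R.
Proof.
by apply: (mulgI (expgz x i)); rewrite mulgV -expgzD subrr.
Qed.

Lemma expgz_expgn x (n : nat) i : expgz (x ^+ n) i = expgz x (i * n)%R.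
Proof.
elim: i => [|m IHm|m IHm]; first by rewrite mul0r.
  by rewrite -addn1 PoszD expgzD1 IHm mulrDl mul1r expgzD.
have -> : (- m.+1%:Z = - m%:Z - 1)%R by lia.
by rewrite expgzB1 IHm mulrBl mul1r expgzD expgzN_nat.
Qed.

Lemma coset_class_mulr (H : set G) x z : subgroup H -> H z ->
  coset_class H (x * z) = coset_class H x.
Proof.
move=> [[_ HM] HV] Hz; apply: eq_exist; apply/seteqP; split=> _ [h Hh <-].
  by exists (z * h); [exact: HM|rewrite mulgA].
by exists (z^-1 * h); [exact/HM/Hh/HV|rewrite mulgA mulgK].
Qed.

Lemma cyclic_subgroupP (x : G) : subgroup (cyclic_subgroup x).
Proof.
split=> [|_ [k _ <-]]; last by exists (- k)%R; rewrite // expgzV.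
split=> [|_ _ [k _ <-] [l _ <-]]; first by exists 0%R.
by exists (k + l)%R; rewrite // expgzD.
Qed.

Lemma center_subgroup : subgroup (@center G).
Proof.
split=> [|z cz x]; last by apply/esym/commuteV/esym/cz.
split=> [x|y z cy cz x]; first by rewrite mul1g mulg1.
by apply: esym; apply: commuteM; apply: esym.
Qed.

Lemma expgz_center (z : G) k : center z -> center (expgz z k).
Proof.
move=> cz x; apply: esym; have cxz : commute x z by exact/esym/cz.
by case: k => n /=; [exact: commuteX|apply: commuteV; exact: commuteX].
Qed.

End GroupPreliminaries.

(** * Walks and graph distances *)

Section GraphDistance.
Variables (R : realType) (X : Type).
Implicit Types (e : X -> X -> Prop) (u v : X).

Lemma walk_mono e1 e2 n u v :
  (forall a b, e1 a b -> e2 a b) -> walk e1 n u v -> walk e2 n u v.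
Proof.
move=> e12; elim: n u => [|n IHn] u //= [w [ew wv]]; exists w; split.
  by case: ew => /e12; [left|right].
exact: IHn.
Qed.

Lemma walk_of_path e n (f : nat -> X) :
  (forall i, (i < n)%N -> e (f i) (f i.+1)) -> walk e n (f 0%N) (f n).
Proof.
elim: n f => [|n IHn] f ef //=; exists (f 1%N); split; first by left; exact: ef.
by apply: (IHn (fun i => f i.+1)) => i ltin; exact: ef.
Qed.

Lemma graph_dist_le e n u v : walk e n u v -> (graph_dist e R u v <= n%:R%:E)%E.
Proof. by move=> wn; apply: ereal_inf_lbound; exists n. Qed.

Lemma graph_dist_ge e (c : R) u v :
  (forall n, walk e n u v -> (c <= n%:R)%R) -> (c%:E <= graph_dist e R u v)%E.
Proof.
move=> cn; apply: le_ereal_inf_tmp => _ [n wn <-]; rewrite lee_fin; exact: cn.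
Qed.

Lemma walk_of_graph_dist e (kappa : R) u v : (graph_dist e R u v <= kappa%:E)%E ->
  exists2 m, (m <= Num.truncn kappa)%N & walk e m u v.
Proof.
move=> dk; apply: contrapT => nowalk.
have : ((Num.truncn kappa).+1%:R%:E <= graph_dist e R u v)%E.
  apply: graph_dist_ge => n wn; rewrite ler_nat ltnNge; apply/negP => nk.
  by apply: nowalk; exists n.
move=> /le_trans/(_ dk); rewrite lee_fin leNgt.
by rewrite Num.Theory.truncnS_gt.
Qed.

End GraphDistance.

(** * Morse lines in a space with convex balls *)

Section MorseLine.
Local Open Scope nat_scope.

Variables (T : Type) (d : T -> T -> nat).

(** Points at distance 0 need not be equal: the case of interest is a
    distance on the group that vanishes within each coset. *)
Record pseudometric : Prop := Pseudometric {
  pm_refl : forall x, d x x = 0;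
  pm_sym : forall x y, d x y = d y x;
  pm_triangle : forall x y z, d x z <= d x y + d y z }.

(** A geodesic that cannot leave a ball containing both of its ends; this is
    the only trace of the lattice structure in the coarse argument. *)
Record convex_path (x y : T) (w : nat -> T) : Prop := ConvexPath {
  cp_start : d (w 0) x = 0;
  cp_end : d (w (d x y)) y = 0;
  cp_lip : forall i j, d (w i) (w j) <= (i - j) + (j - i);
  cp_ball : forall p r, d p x <= r -> d p y <= r -> forall i, d p (w i) <= r }.

Hypothesis pm : pseudometric.
Hypothesis convex_pathP : forall x y, exists w, convex_path x y w.

Variables (gamma : int -> T) (L M : nat).

Definition discrete_qi : Prop := forall i j : int,
  `|i - j|%N <= L * d (gamma i) (gamma j) + L /\
  d (gamma i) (gamma j) <= L * `|i - j|%N + L.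

(** The Morse property for paths with integer parameter and the quasi-geodesic
    constants (4, 0), those of [concat3_quasi_geodesic]. *)
Definition discrete_morse : Prop := forall (n : nat) (q : nat -> T) (a b : int),
  (forall i j, i <= n -> j <= n ->
     (i - j) + (j - i) <= 4 * d (q i) (q j) /\
     d (q i) (q j) <= (i - j) + (j - i)) ->
  d (q 0) (gamma a) = 0 -> d (q n) (gamma b) = 0 ->
  forall i, i <= n -> exists k, d (q i) (gamma k) <= M.

Hypothesis gamma_qi : discrete_qi.
Hypothesis gamma_morse : discrete_morse.

Definition nearest (k : int) (q : T) : Prop :=
  forall l, d q (gamma k) <= d q (gamma l).

Lemma exists_nearest q : exists k, nearest k q.
Proof.
have ex : exists n, `[< exists k, d q (gamma k) = n >].
  by exists (d q (gamma 0)); apply/asboolP; exists 0%R.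
case: (ex_minnP ex) => m /asboolP [k km] minm.
by exists k => l; rewrite km; apply: minm; apply/asboolP; exists l.
Qed.

Lemma nearest_ext k x y : d x y = 0 -> nearest k x -> nearest k y.
Proof.
move=> xy nx l; have := nx l.
have := pm_triangle pm x y (gamma l); have := pm_triangle pm y x (gamma k).
by rewrite (pm_sym pm y x); lia.
Qed.

Lemma cp_iso x y w i j : convex_path x y w -> i <= d x y -> j <= d x y ->
  d (w i) (w j) = (i - j) + (j - i).
Proof.
move=> cw; wlog ij : i j / i <= j => [H|] im jm.
  have [ij|/ltnW ji] := leqP i j; first exact: H.
  by rewrite (pm_sym pm) H //; lia.
have := cp_lip cw i j; have := cp_lip cw 0 i; have := cp_lip cw j (d x y).
have := cp_start cw; have := cp_end cw.
set n := d x y in im jm *.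
have : d x y = n by [].
have := pm_triangle pm x (w 0) y; have := pm_triangle pm (w 0) (w i) y.
have := pm_triangle pm (w i) (w j) y; have := pm_triangle pm (w j) (w n) y.
by rewrite (pm_sym pm x (w 0)); lia.
Qed.

Lemma cp_dist_start x y w i : convex_path x y w -> i <= d x y -> d x (w i) = i.
Proof.
move=> cw im; have := cp_iso cw (leq0n _) im; have := cp_start cw.
have := pm_triangle pm x (w 0) (w i); have := pm_triangle pm (w 0) x (w i).
by rewrite (pm_sym pm x (w 0)); lia.
Qed.

Lemma cp_dist_end x y w i : convex_path x y w -> i <= d x y ->
  d (w i) y = d x y - i.
Proof.
move=> cw im; have := cp_iso cw im (leqnn _); have := cp_end cw.
have := pm_triangle pm (w i) (w (d x y)) y.
have := pm_triangle pm (w i) y (w (d x y)).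
by rewrite (pm_sym pm y); lia.
Qed.

Definition concat3 a b (w1 w2 w3 : nat -> T) (t : nat) : T :=
  if t <= a then w1 t else if t <= a + b then w2 (t - a) else w3 (t - a - b).

(** Coming from the first leg and going to the third one, a path cannot be
    shortened through its middle leg, since the ends of the middle leg are the
    points of that leg nearest to the outer legs; and the outer legs are kept
    apart by the length of the middle leg, which is at least ten times that of
    the first one. *)
Lemma concat3_quasi_geodesic a b c w1 w2 w3 :
  (forall i j, i <= a -> j <= a -> d (w1 i) (w1 j) = (i - j) + (j - i)) ->
  (forall i j, i <= b -> j <= b -> d (w2 i) (w2 j) = (i - j) + (j - i)) ->
  (forall i j, i <= c -> j <= c -> d (w3 i) (w3 j) = (i - j) + (j - i)) ->
  d (w1 a) (w2 0) = 0 -> d (w2 b) (w3 0) = 0 ->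
  (forall i j, i <= a -> j <= b -> a - i <= d (w1 i) (w2 j)) ->
  (forall i j, i <= b -> j <= c -> j <= d (w2 i) (w3 j)) ->
  (forall i j, i <= a -> j <= c -> j <= d (w1 i) (w3 j) + (a - i)) ->
  10 * a <= b ->
  forall i j, i <= a + b + c -> j <= a + b + c ->
    let q := concat3 a b w1 w2 w3 in
    (i - j) + (j - i) <= 4 * d (q i) (q j) /\ d (q i) (q j) <= (i - j) + (j - i).
Proof.
move=> i1 i2 i3 e12 e23 h12 h23 h13 ab i j im jm /=.
wlog ij : i j im jm / i <= j => [H|].
  have [ij|/ltnW ji] := leqP i j; first exact: H.
  by rewrite (pm_sym pm); have [] := H j i jm im ji; lia.
rewrite /concat3.
have [ja|aj] := leqP j a.
  by rewrite (leq_trans ij ja) i1 //; lia.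
have [jb|bj] := leqP j (a + b).
  have [ia|ai] := leqP i a; last by rewrite (leq_trans ij jb) i2; lia.
  have := h12 i (j - a) ia; have := i1 i a ia (leqnn a).
  have := i2 0 (j - a) (leq0n _).
  have := pm_triangle pm (w1 i) (w1 a) (w2 (j - a)).
  have := pm_triangle pm (w1 a) (w2 0) (w2 (j - a)).
  have := pm_triangle pm (w2 0) (w1 a) (w2 (j - a)).
  have := pm_triangle pm (w1 a) (w1 i) (w2 (j - a)).
  by rewrite (pm_sym pm (w2 0) (w1 a)) (pm_sym pm (w1 a) (w1 i)); lia.
have jc : j - a - b <= c by lia.
have t1 := pm_triangle pm (w2 b) (w3 0) (w3 (j - a - b)).
have t2 := pm_triangle pm (w2 b) (w3 (j - a - b)) (w3 0).
have s1 := pm_sym pm (w3 (j - a - b)) (w3 0).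
have h3 := i3 0 (j - a - b) (leq0n _) jc.
have [ia|ai] := leqP i a; last first.
  have [ib|bi] := leqP i (a + b); last by rewrite i3; lia.
  have iab : i - a <= b by lia.
  have := h23 (i - a) _ iab jc; have := i2 (i - a) b iab (leqnn b).
  have := pm_triangle pm (w2 (i - a)) (w2 b) (w3 (j - a - b)).
  have := pm_triangle pm (w2 (i - a)) (w3 (j - a - b)) (w2 b).
  by rewrite (pm_sym pm (w3 _) (w2 b)); lia.
have := h13 i _ ia jc; have := i1 i a ia (leqnn a).
have := i2 0 b (leq0n _) (leqnn b).
have := pm_triangle pm (w1 i) (w1 a) (w3 (j - a - b)).
have := pm_triangle pm (w1 a) (w2 0) (w3 (j - a - b)).
have := pm_triangle pm (w2 0) (w2 b) (w3 (j - a - b)).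
have := pm_triangle pm (w2 0) (w1 a) (w2 b).
have := pm_triangle pm (w1 a) (w1 i) (w2 b).
have := pm_triangle pm (w1 i) (w3 (j - a - b)) (w2 b).
have := h23 b _ (leqnn b) jc.
rewrite (pm_sym pm (w2 0) (w1 a)) (pm_sym pm (w1 a) (w1 i)).
rewrite (pm_sym pm (w3 _) (w2 b)); lia.
Qed.

(** The detour in [geodesic_near_projection] has a first leg of length M + 1
    and, when it is not a quasi-geodesic, a middle leg of length at most
    10 (M + 1). *)
Definition proj_gap := 12 * M.+1.

(** The detour is made of the segment of length M + 1 from the projection x
    towards q, a convex path inside the ball about q of radius r - (M + 1),
    and the rest of the geodesic from q to gamma l.  It leaves the
    M-neighbourhood of the axis at its first corner, so it is not a
    quasi-geodesic and its middle leg is short. *)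
Lemma geodesic_near_projection q k l w :
  nearest k q -> convex_path q (gamma l) w ->
  exists2 t, t <= d q (gamma l) & d (w t) (gamma k) <= proj_gap.
Proof.
move=> nk cw; rewrite /proj_gap; set i := M.+1; set x := gamma k; set z := gamma l.
set r := d q x.
have rz : r <= d q z := nk l.
have [ri|ir] := leqP r i.
  exists 0 => //; have := pm_triangle pm (w 0) q x; rewrite (cp_start cw) -/r; lia.
have [v cv] := convex_pathP q x.
have [u cu] := convex_pathP (v (r - i)) (w (r - i)).
have dv : d q (v (r - i)) = r - i by apply: (cp_dist_start cv); rewrite -/r; lia.
have dw : d q (w (r - i)) = r - i by apply: (cp_dist_start cw); rewrite -/z; lia.
set b := d (v (r - i)) (w (r - i)).
have du j : d q (u j) <= r - i by apply: (cp_ball cu); lia.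
exists (r - i); first by rewrite -/z; lia.
have dvx : d (v (r - i)) x = i by rewrite (cp_dist_end cv) -/r; lia.
(* A short middle leg already brings w (r - i) close to x. *)
have [bi|ib] := leqP b (10 * i).
  have := pm_triangle pm (w (r - i)) (v (r - i)) x.
  by rewrite (pm_sym pm (w _) (v _)) -/b dvx; lia.
pose c := concat3 i b (fun s => v (r - s)) u (fun s => w (r - i + s)).
pose n := i + b + (d q z - r + i).
have qc : forall s t, s <= n -> t <= n ->
    (s - t) + (t - s) <= 4 * d (c s) (c t) /\ d (c s) (c t) <= (s - t) + (t - s).
  have dvi s : s <= i -> d q (v (r - s)) = r - s.
    by move=> si; apply: (cp_dist_start cv); rewrite -/r; lia.
  have dwi s : s <= d q z - r + i -> d q (w (r - i + s)) = r - i + s.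
    by move=> si; apply: (cp_dist_start cw); rewrite -/z; lia.
  apply: concat3_quasi_geodesic; last by lia.
  - by move=> s t si ti; rewrite (cp_iso cv) -/x -/r; lia.
  - by move=> s t sb tb; apply: (cp_iso cu).
  - by move=> s t si ti; rewrite (cp_iso cw) -/z; lia.
  - by rewrite (pm_sym pm); exact: cp_start cu.
  - by rewrite addn0; exact: cp_end cu.
  - move=> s t si tb; have := du t; have := dvi s si.
    by have := pm_triangle pm q (u t) (v (r - s)); rewrite (pm_sym pm (u t)); lia.
  - move=> s t sb tc; have := du s; have := dwi t tc.
    by have := pm_triangle pm q (u s) (w (r - i + t)); lia.
  - move=> s t si tc; have := dvi s si; have := dwi t tc.
    by have := pm_triangle pm q (v (r - s)) (w (r - i + t)); lia.
have c0 : d (c 0) (gamma k) = 0.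
  by rewrite /c /concat3 /= subn0; exact: cp_end cv.
have cn : d (c n) (gamma l) = 0.
  rewrite /c /concat3 ifF; last by apply/negbTE; lia.
  have [cb|_] := leqP n (i + b); first by lia.
  have -> : r - i + (n - i - b) = d q z by lia.
  exact: cp_end cw.
(* The corner at time i is at distance i = M + 1 from the axis. *)
have [m] := gamma_morse qc c0 cn (i := i) (leq_trans (leq_addr b i) (leq_addr _ _)).
rewrite /c /concat3 leqnn; have := nk m; rewrite -/x -/r.
by have := pm_triangle pm q (v (r - i)) (gamma m); lia.
Qed.

(** A geodesic from q passes near the projection of q on its way to any point
    of the axis. *)
Lemma nearest_detour q k l : nearest k q ->
  d q (gamma k) + d (gamma k) (gamma l) <= d q (gamma l) + 2 * proj_gap.
Proof.
move=> nk; have [w cw] := convex_pathP q (gamma l).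
have [t tl near_t] := geodesic_near_projection nk cw.
have := cp_dist_start cw tl; have := cp_dist_end cw tl.
have := pm_triangle pm q (w t) (gamma k).
have := pm_triangle pm (gamma k) (w t) (gamma l).
by rewrite (pm_sym pm (gamma k) (w t)); lia.
Qed.

(** A convex geodesic from q to the projection of p stays in the ball of
    centre p that contains q and touches the axis, and it passes near the
    projection y of q.  So y is hardly farther from p than the axis is, which
    forces y to be close to the projection of p. *)
Lemma strongly_contracting p q k l : nearest k p -> nearest l q ->
  d p q <= d p (gamma k) -> d (gamma k) (gamma l) <= 3 * proj_gap.
Proof.
move=> nk nl pq; have [w cw] := convex_pathP q (gamma k).
have [t tl near_t] := geodesic_near_projection nl cw.
have := cp_ball cw pq (leqnn _) t; have := nearest_detour l nk.
by have := pm_triangle pm p (w t) (gamma l); lia.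
Qed.

Lemma nearest_coarsely_unique p k l :
  nearest k p -> nearest l p -> d (gamma k) (gamma l) <= 3 * proj_gap.
Proof.
by move=> nk nl; apply: strongly_contracting nk nl _; rewrite pm_refl.
Qed.

(** The contrapositive of strong contraction makes d p q exceed the distance
    from p to the axis; then the same ball argument gives an estimate. *)
Lemma far_projections p q k l : nearest k p -> nearest l q ->
  3 * proj_gap < d (gamma k) (gamma l) ->
  d p (gamma k) + d (gamma k) (gamma l) <= d p q + 3 * proj_gap.
Proof.
move=> nk nl kl; have [|pq] := leqP (d p q) (d p (gamma k)).
  by move/(strongly_contracting nk nl); lia.
have [w cw] := convex_pathP q (gamma k).
have [t tl near_t] := geodesic_near_projection nl cw.
have := cp_ball cw (leqnn (d p q)) (ltnW pq) t; have := nearest_detour l nk.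
by have := pm_triangle pm p (w t) (gamma l); lia.
Qed.

Definition proj_step := 3 * proj_gap + 2.
Definition proj_far := 6 * proj_gap + proj_step + 1.

Lemma nearest_step p q k l : nearest k p -> nearest l q ->
  d p q <= 1 -> d (gamma k) (gamma l) <= proj_step.
Proof.
move=> nk nl pq; rewrite /proj_step.
have [pk|] := leqP (d p q) (d p (gamma k)).
  by have := strongly_contracting nk nl pk; lia.
have := nl k; have := pm_triangle pm q p (gamma k).
have := pm_triangle pm (gamma k) p (gamma l).
have := pm_triangle pm p q (gamma l).
by rewrite (pm_sym pm q p) (pm_sym pm (gamma k) p); lia.
Qed.

(** Projections move by at most [proj_step] along each edge, so they take
    every value of the distance to gamma k up to that error. *)
Lemma projections_along_path u v w k l (c : nat) :
  convex_path u v w -> nearest k u -> nearest l v ->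
  3 * proj_gap <= c -> c + 3 * proj_gap <= d (gamma k) (gamma l) ->
  exists j m, [/\ j <= d u v, nearest m (w j),
    c <= d (gamma k) (gamma m) & d (gamma k) (gamma m) <= c + proj_step].
Proof.
move=> cw nk nl c0 cn.
have [pi nearest_pi] := choice (fun j => exists_nearest (w j)).
have n0 : nearest (pi 0) u := nearest_ext (cp_start cw) (nearest_pi 0).
have nn : nearest (pi (d u v)) v := nearest_ext (cp_end cw) (nearest_pi _).
have f0 : d (gamma k) (gamma (pi 0)) <= c.
  by apply: leq_trans c0; exact: nearest_coarsely_unique nk n0.
have fn : c <= d (gamma k) (gamma (pi (d u v))).
  have := nearest_coarsely_unique nn nl.
  have := pm_triangle pm (gamma k) (gamma (pi (d u v))) (gamma l); lia.
have fS j : j < d u v ->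
    d (gamma k) (gamma (pi j.+1)) <= d (gamma k) (gamma (pi j)) + proj_step.
  move=> _; have ww : d (w j) (w j.+1) <= 1 by have := cp_lip cw j j.+1; lia.
  have := nearest_step (nearest_pi j) (nearest_pi j.+1) ww.
  have := pm_triangle pm (gamma k) (gamma (pi j)) (gamma (pi j.+1)); lia.
have [j [jn cj jc]] := discrete_ivt f0 fn fS.
by exists j, (pi j); split.
Qed.

(** Cut a geodesic from u to v at a point whose projection is far from both
    end projections, and add the two estimates of [far_projections]. *)
Lemma four_point u v k l : nearest k u -> nearest l v ->
  proj_far < d (gamma k) (gamma l) ->
  d u (gamma k) + d (gamma k) (gamma l) + d v (gamma l) <= d u v + 6 * proj_gap.
Proof.
move=> nk nl; rewrite /proj_far => kl; have [w cw] := convex_pathP u v.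
have [||j [m [jn nm cj jc]]] :=
  @projections_along_path u v w k l (3 * proj_gap).+1 cw nk nl; [lia|lia|].
have := far_projections nk nm cj.
have lm : 3 * proj_gap < d (gamma l) (gamma m).
  have := pm_triangle pm (gamma k) (gamma m) (gamma l).
  by rewrite (pm_sym pm (gamma m)); lia.
have := far_projections nl nm lm; rewrite (pm_sym pm v (w j)).
rewrite (cp_dist_start cw jn) (cp_dist_end cw jn).
have := pm_triangle pm (gamma k) (gamma m) (gamma l).
by rewrite (pm_sym pm (gamma m)); lia.
Qed.

(** Applying [four_point] to both halves of the path counts the distance from
    w j to the axis twice, while the triangle inequality leaves room only for a
    bounded multiple of [proj_gap]. *)
Lemma path_near_axis u v w k l m j : convex_path u v w -> j <= d u v ->
  nearest k u -> nearest l v -> nearest m (w j) ->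
  proj_far < d (gamma k) (gamma m) -> proj_far < d (gamma m) (gamma l) ->
  d (w j) (gamma m) <= 6 * proj_gap.
Proof.
move=> cw jn nk nl nm km ml.
have := four_point nk nm km; have := four_point nm nl ml.
rewrite (cp_dist_start cw jn) (cp_dist_end cw jn).
have := pm_triangle pm u (gamma k) v.
have := pm_triangle pm (gamma k) (gamma l) v.
have := pm_triangle pm (gamma k) (gamma m) (gamma l).
by rewrite (pm_sym pm (gamma l) v); lia.
Qed.

Definition index_step := L * (2 * M + 1) + L.
Definition between_gap := 2 * (M + L * index_step + L).

(** A geodesic from gamma e to gamma b stays near the axis, and the index of a
    nearby axis point changes by bounded steps from e to b along it; so the
    geodesic passes near gamma a. *)
Lemma near_between (e a b : int) : (e <= a)%R -> (a <= b)%R ->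
  d (gamma e) (gamma a) + d (gamma a) (gamma b) <= d (gamma e) (gamma b) + between_gap.
Proof.
move=> ea ab; have [w cw] := convex_pathP (gamma e) (gamma b).
set n := d (gamma e) (gamma b).
have isow i j : i <= n -> j <= n ->
    (i - j) + (j - i) <= 4 * d (w i) (w j) /\ d (w i) (w j) <= (i - j) + (j - i).
  by move=> im jm; rewrite (cp_iso cw im jm); lia.
have ex i : exists k, i <= n -> d (w i) (gamma k) <= M.
  have [im|_] := leqP i n; last by exists 0%R.
  by have [k] := gamma_morse isow (cp_start cw) (cp_end cw) im; exists k.
have [idx near_idx] := choice ex.
suff [[m nm]|[|]] : (exists2 m, m <= n & `|idx m - a|%N <= index_step) \/
    (`|a - e|%N <= index_step \/ `|b - a|%N <= index_step).
- have := near_idx m nm; have [_] := gamma_qi (idx m) a => g1 g2 g3.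
  have : d (gamma (idx m)) (gamma a) <= L * index_step + L.
    by apply: leq_trans g1 _; rewrite leq_add2r leq_mul2l g3 orbT.
  have := cp_dist_start cw nm; have := cp_dist_end cw nm.
  have := pm_triangle pm (gamma e) (w m) (gamma a).
  have := pm_triangle pm (gamma a) (w m) (gamma b).
  have := pm_triangle pm (w m) (gamma (idx m)) (gamma a).
  by rewrite (pm_sym pm (gamma a) (w m)) /between_gap -/n; lia.
- move=> g3; have [_ g1] := gamma_qi a e.
  have : d (gamma a) (gamma e) <= L * index_step + L.
    by apply: leq_trans g1 _; rewrite leq_add2r leq_mul2l g3 orbT.
  have := pm_triangle pm (gamma a) (gamma e) (gamma b).
  by rewrite (pm_sym pm (gamma a) (gamma e)) /between_gap -/n; lia.
- move=> g3; have [_ g1] := gamma_qi b a.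
  have : d (gamma b) (gamma a) <= L * index_step + L.
    by apply: leq_trans g1 _; rewrite leq_add2r leq_mul2l g3 orbT.
  have := pm_triangle pm (gamma e) (gamma b) (gamma a).
  by rewrite (pm_sym pm (gamma b) (gamma a)) /between_gap -/n; lia.
have [|ea'] := leqP `|a - e|%N index_step; first by right; left.
have [|ab'] := leqP `|b - a|%N index_step; first by right; right.
left.
have idxJ (i j : int) : d (gamma i) (gamma j) <= 2 * M + 1 -> `|i - j|%N <= index_step.
  move=> dij; have [+ _] := gamma_qi i j; move/leq_trans; apply.
  by rewrite leq_add2r leq_mul2l dij orbT.
(* The position of the nearby axis point, measured from e and cut off below. *)
pose f j := if (e <= idx j)%R then `|idx j - e|%N else 0.
have f0 : f 0 <= `|a - e|%N.
  have : `|idx 0 - e|%N <= index_step.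
    apply: idxJ; have := near_idx 0 (leq0n _); have := cp_start cw.
    have := pm_triangle pm (gamma (idx 0)) (w 0) (gamma e).
    by rewrite (pm_sym pm (gamma (idx 0)) (w 0)); lia.
  by rewrite /f; case: ifP => //; lia.
have fn : `|a - e|%N <= f n.
  have : `|idx n - b|%N <= index_step.
    apply: idxJ; have := near_idx n (leqnn n); have := cp_end cw.
    have := pm_triangle pm (gamma (idx n)) (w n) (gamma b).
    by rewrite (pm_sym pm (gamma (idx n)) (w n)) -/n; lia.
  by rewrite /f; case: ifP => //; lia.
have fS j : j < n -> f j.+1 <= f j + index_step.
  move=> jn; have : `|idx j - idx j.+1|%N <= index_step.
    apply: idxJ; have := near_idx j (ltnW jn); have := near_idx j.+1 jn.
    have := cp_lip cw j j.+1.
    have := pm_triangle pm (gamma (idx j)) (w j) (gamma (idx j.+1)).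
    have := pm_triangle pm (w j) (w j.+1) (gamma (idx j.+1)).
    by rewrite (pm_sym pm (gamma (idx j)) (w j)); lia.
  by rewrite /f; do 2 case: ifP => //; lia.
have [j [jn cj jc]] := discrete_ivt f0 fn fS.
by exists j => //; move: cj jc; rewrite /f; case: ifP; lia.
Qed.

Definition separation := 14 * proj_gap + between_gap + 1.

(** On a quasi-line, points almost equidistant from gamma e that are far from
    each other lie on different sides of gamma e. *)
Lemma equidistant_opposite (e a b : int) :
  d (gamma e) (gamma a) <= d (gamma e) (gamma b) + 14 * proj_gap ->
  d (gamma e) (gamma b) <= d (gamma e) (gamma a) + 14 * proj_gap ->
  separation <= d (gamma a) (gamma b) ->
  (a < e < b)%R || (b < e < a)%R.
Proof.
rewrite /separation => dab dba Eab; apply/negPn/negP => same.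
have := @near_between e a b; have := @near_between e b a.
have := @near_between a b e; have := @near_between b a e.
rewrite (pm_sym pm (gamma b) (gamma a)) (pm_sym pm (gamma b) (gamma e)).
rewrite (pm_sym pm (gamma a) (gamma e)); lia.
Qed.

(** Room for the three sample points of [sphere_projection], with a margin
    [proj_far] at both ends. *)
Definition sphere_gap :=
  (proj_far + 1) + 2 * (proj_step + separation) + proj_step + proj_far +
  3 * proj_gap.

(** If the projections were far apart, the path would run close to the axis at
    three distant points.  These would be almost equidistant from the
    projection of the centre p, and two of them would lie on the same side of
    it, against [equidistant_opposite]. *)
Lemma sphere_projection u v w p rho k l : convex_path u v w ->
  (forall j, j <= d u v -> d p (w j) = rho) ->
  nearest k u -> nearest l v -> d (gamma k) (gamma l) <= sphere_gap.
Proof.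
move=> cw sph nk nl; rewrite leqNgt; apply/negP; rewrite /sphere_gap => Kkl.
have [e ne] := exists_nearest p.
have sample c : proj_far + 1 <= c ->
    c <= proj_far + 1 + 2 * (proj_step + separation) ->
    exists m, [/\ c <= d (gamma k) (gamma m), d (gamma k) (gamma m) <= c + proj_step,
      rho <= d p (gamma e) + d (gamma e) (gamma m) + 6 * proj_gap &
      d p (gamma e) + d (gamma e) (gamma m) <= rho + 8 * proj_gap].
  move=> c1 c2; have [||j [m [jn nm cm mc]]] :=
    @projections_along_path u v w k l c cw nk nl; [by rewrite /proj_far in c1; lia|lia|].
  have ml : proj_far < d (gamma m) (gamma l).
    by have := pm_triangle pm (gamma k) (gamma m) (gamma l); lia.
  have := @path_near_axis u v w k l m j cw jn nk nl nm; rewrite -(sph j jn).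
  move=> near_axis; exists m; split=> //.
    have := pm_triangle pm p (gamma m) (w j).
    have := pm_triangle pm p (gamma e) (gamma m).
    by rewrite (pm_sym pm (gamma m) (w j)); lia.
  have := pm_triangle pm p (w j) (gamma m).
  by have := nearest_detour m ne; lia.
(* Samples at spacing proj_step + separation have projections at least
   separation apart. *)
have [||m1 [a1 b1 c1 e1]] := sample (proj_far + 1); [lia|lia|].
have [||m2 [a2 b2 c2 e2]] :=
  sample (proj_far + 1 + (proj_step + separation)); [lia|lia|].
have [||m3 [a3 b3 c3 e3]] :=
  sample (proj_far + 1 + 2 * (proj_step + separation)); [lia|lia|].
have opp m m' : d (gamma e) (gamma m) <= d (gamma e) (gamma m') + 14 * proj_gap ->
    d (gamma e) (gamma m') <= d (gamma e) (gamma m) + 14 * proj_gap ->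
    d (gamma k) (gamma m) + separation <= d (gamma k) (gamma m') ->
    (m < e < m')%R || (m' < e < m)%R.
  move=> h1 h2 h3; apply: equidistant_opposite => //.
  have := pm_triangle pm (gamma k) (gamma m) (gamma m'); lia.
have := opp m1 m2; have := opp m2 m3; have := opp m1 m3; lia.
Qed.

End MorseLine.

(** * The prefix order of a Garside group *)

Section GarsideOrder.
Local Open Scope classical_set_scope.
Local Open Scope group_scope.

Variables (G : groupType) (Gp : set G) (Delta : G).
Hypothesis HG : garside Gp Delta.
Implicit Types (x y g h : G) (k l : int).

Local Notation "x <<= y" := (prefix_le Gp x y) (at level 70).
Local Notation D := (expgz Delta).

Lemma pos1 : Gp 1. Proof. by case: (garside_submonoid HG). Qed.

Lemma posM x y : Gp x -> Gp y -> Gp (x * y).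
Proof. by case: (garside_submonoid HG) => _; apply. Qed.

Lemma prefix_trans y x z : x <<= y -> y <<= z -> x <<= z.
Proof. by move=> xy yz; exact: lo_trans (garside_prefix HG) _ _ _ xy yz. Qed.

Lemma prefix_refl x : x <<= x.
Proof. exact: lo_refl (garside_prefix HG) x. Qed.

Lemma prefix_mul2l z x y : (z * x <<= z * y) <-> (x <<= y).
Proof. by rewrite /prefix_le invgM -mulgA mulKg. Qed.

(** Balancedness: the complement of a simple element to Delta is both a prefix
    and a suffix of Delta. *)
Lemma simple_complement x : simples Gp Delta x -> simples Gp Delta (x^-1 * Delta).
Proof.
move=> [px xD]; rewrite (garside_balanced HG); split=> //=.
by rewrite /suffix_ge invgM invgK mulVKg.
Qed.

Lemma simple_left_complement x :
  simples Gp Delta x -> simples Gp Delta (Delta * x^-1).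
Proof.
rewrite {1}(garside_balanced HG) => -[px Dx]; split=> //=.
by rewrite /prefix_le invgM invgK mulgVK.
Qed.

(** Taking complements twice is conjugation by Delta; thus conjugation by
    Delta preserves the simple elements, hence the monoid they generate. *)
Lemma pos_tau x : Gp x -> Gp (Delta^-1 * x * Delta).
Proof.
move: x; suff: Gp `<=` [set x | Gp (Delta^-1 * x * Delta)] by [].
rewrite -{1}(garside_gen_monoid HG); apply: smallest_sub.
  split=> /= [|x y px py]; first by rewrite mulg1 mulVg; exact: pos1.
  by have := posM px py; rewrite !mulgA mulgK.
by move=> x /simple_complement/simple_complement[] /=; rewrite invgM invgK.
Qed.

Lemma pos_tauV x : Gp x -> Gp (Delta * x * Delta^-1).
Proof.
move: x; suff: Gp `<=` [set x | Gp (Delta * x * Delta^-1)] by [].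
rewrite -{1}(garside_gen_monoid HG); apply: smallest_sub.
  split=> /= [|x y px py]; first by rewrite mulg1 mulgV; exact: pos1.
  by have := posM px py; rewrite !mulgA mulgVK.
move=> x /simple_left_complement/simple_left_complement[] /=.
by rewrite invgM invgK mulgA.
Qed.

Lemma pos_conj x k : Gp x -> Gp ((D k)^-1 * x * D k).
Proof.
move=> px; elim: k => [|n IHn|n IHn]; first by rewrite invg1 mulg1 mul1g.
  rewrite -addn1 PoszD expgzD1 invgM.
  by have := pos_tau IHn; rewrite !mulgA.
have -> : (- n.+1%:Z = - n%:Z - 1)%R by lia.
by rewrite expgzB1 invgM invgK; have := pos_tauV IHn; rewrite !mulgA.
Qed.

Lemma pos_conjV x k : Gp x -> Gp (D k * x * (D k)^-1).
Proof. by move/(pos_conj (- k)%R); rewrite -expgzV invgK. Qed.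

(** Left translations preserve the prefix order by definition; right
    translations by powers of Delta do because Delta normalises the monoid. *)
Lemma prefix_mulD k x y : (x * D k <<= y * D k) <-> (x <<= y).
Proof.
rewrite /prefix_le invgM; split=> [/(pos_conjV k)|/(pos_conj k)].
  by rewrite !mulgA mulgV mul1g mulgK.
by rewrite !mulgA.
Qed.

Lemma pos_D (n : nat) : Gp (D n).
Proof.
elim: n => [|n IHn]; first exact: pos1.
by rewrite -addn1 PoszD expgzD1; apply: posM IHn _; exact: garside_Delta HG.
Qed.

Lemma prefix_D i j : (i <= j)%R -> D i <<= D j.
Proof.
move=> ij; rewrite /prefix_le expgzV -expgzD.
have -> : (- i + j = `|j - i|%N%:Z)%R by lia.
exact: pos_D.
Qed.

Lemma prefix_mulr x y : Gp y -> x <<= x * y.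
Proof. by rewrite /prefix_le mulKg. Qed.

Lemma prefix_mulDr x k : (0 <= k)%R -> x <<= x * D k.
Proof.
by move=> k0; apply: prefix_mulr; have := prefix_D k0; rewrite /prefix_le invg1 mul1g.
Qed.

Lemma D_le_mul k l g h : D k <<= g -> D l <<= h -> D (k + l)%R <<= g * h.
Proof.
rewrite /prefix_le => kg lh; have := posM (pos_conj l kg) lh.
by rewrite expgzD invgM !mulgA mulgK.
Qed.

Lemma mul_le_D k l g h : g <<= D k -> h <<= D l -> g * h <<= D (k + l)%R.
Proof.
rewrite /prefix_le => gk hl; have := posM hl (pos_conj l gk).
by rewrite expgzD invgM -!mulgA mulVKg.
Qed.

Lemma D_le_inv k g : g <<= D k -> D (- k)%R <<= g^-1.
Proof.
rewrite /prefix_le => /(pos_conjV k).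
by rewrite -expgzV invgK -!mulgA mulgV mulg1.
Qed.

Lemma inv_le_D k g : D k <<= g -> g^-1 <<= D (- k)%R.
Proof.
rewrite /prefix_le => /(pos_conjV k).
by rewrite -expgzV invgK mulgA mulgV mul1g.
Qed.

Lemma bounded_by_D g : exists k l, D k <<= g /\ g <<= D l.
Proof.
suff: [set: G] `<=` [set g | exists k l, D k <<= g /\ g <<= D l] by apply.
rewrite -(garside_gen_group HG); apply: smallest_sub.
  split; [split|] => /=.
  - by exists 0%R, 0%R; split; apply: prefix_refl.
  - move=> x y [k [l [kx xl]]] [k' [l' [ky yl]]].
    by exists (k + k')%R, (l + l')%R; split; [exact: D_le_mul|exact: mul_le_D].
  - move=> x [k [l [kx xl]]]; exists (- l)%R, (- k)%R.
    by split; [exact: D_le_inv|exact: inv_le_D].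
move=> x [px xD]; exists 0%R, 1%R; split=> //.
by rewrite /prefix_le invg1 mul1g.
Qed.

(** * Infimum, supremum and the distance between cosets *)

Hypothesis D1 : Delta <> 1.

(** When Delta is not trivial it has infinite order, so that infimum and
    supremum exist. *)
Lemma prefix_DP i j : (D i <<= D j) <-> (i <= j)%R.
Proof.
split; last exact: prefix_D.
move=> ij; rewrite leNgt; apply/negP => ji; apply: D1.
apply: (garside_antisym HG (garside_Delta HG)).
have -> : Delta^-1 = D (- i + j)%R * D `|(i - j - 1)%R|%N.
  rewrite -expgzD; have -> : (- i + j + `|(i - j - 1)%R|%N)%R = (- 1%:Z)%R by lia.
  by rewrite expgzN_nat expg1.
apply: posM; last exact: pos_D.
by rewrite expgzD -expgzV.
Qed.

Lemma ginfP k g : (D k <<= g) <-> (k <= ginf Gp Delta g)%R.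
Proof.
pose S := [set r : int | D r <<= g].
have [k0 [l0 [k0g gl0]]] := bounded_by_D g.
have [] : (S `&` ubound S) (ginf Gp Delta g).
  rewrite /ginf; apply: xgetPex.
  have [||m [Sm um]] := @int_max S; last by exists m.
    by exists k0.
  exists l0 => r Sr; apply/prefix_DP; exact: prefix_trans Sr gl0.
move=> Sg ug; split; first exact: ug.
move=> kg; apply: prefix_trans Sg; exact: prefix_D.
Qed.

Lemma gsupP k g : (g <<= D k) <-> (gsup Gp Delta g <= k)%R.
Proof.
pose S := [set r : int | g <<= D r].
have [k0 [l0 [k0g gl0]]] := bounded_by_D g.
have [] : (S `&` lbound S) (gsup Gp Delta g).
  rewrite /gsup; apply: xgetPex.
  have [||m [Sm um]] := @int_max [set r | S (- r)%R].
  - by exists (- l0)%R; rewrite /= opprK.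
  - exists (- k0)%R => r Sr; rewrite lerNr; apply/prefix_DP.
    exact: prefix_trans k0g Sr.
  exists (- m)%R; split=> // r Sr; rewrite lerNl; apply: um.
  by rewrite /= opprK.
move=> Sg ug; split; first exact: ug.
move=> kg; apply: prefix_trans Sg _; exact: prefix_D.
Qed.

Lemma ginf_le_gsup g : (ginf Gp Delta g <= gsup Gp Delta g)%R.
Proof.
apply/prefix_DP; apply: (@prefix_trans g); first exact/ginfP.
exact/gsupP.
Qed.

Lemma ginf_mono g h : g <<= h -> (ginf Gp Delta g <= ginf Gp Delta h)%R.
Proof. by move=> gh; apply/ginfP; apply: prefix_trans gh; apply/ginfP. Qed.

Lemma gsup_mono g h : g <<= h -> (gsup Gp Delta g <= gsup Gp Delta h)%R.
Proof. by move=> gh; apply/gsupP; apply: prefix_trans gh _; apply/gsupP. Qed.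

Definition dist (x y : G) : nat :=
  `|gsup Gp Delta (x^-1 * y)%g - ginf Gp Delta (x^-1 * y)%g|%N.

(** Balls are unions of lattice intervals. *)
Lemma dist_leP x y (n : nat) : (dist x y <= n)%N <->
  exists k, x * D k <<= y /\ y <<= x * D (k + n%:Z)%R.
Proof.
have le_inf k : (x * D k <<= y) <-> (k <= ginf Gp Delta (x^-1 * y)%g)%R.
  by rewrite -ginfP -(prefix_mul2l x (D k)) mulVKg.
have le_sup k : (y <<= x * D k) <-> (gsup Gp Delta (x^-1 * y)%g <= k)%R.
  by rewrite -gsupP -(prefix_mul2l x (x^-1 * y)) mulVKg.
rewrite /dist; have le_is := ginf_le_gsup (x^-1 * y)%g; split.
  move=> dn; exists (ginf Gp Delta (x^-1 * y)%g); rewrite le_inf le_sup; split=> //.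
  by lia.
by move=> [k]; rewrite le_inf le_sup; lia.
Qed.

Lemma dist_mull z x y : dist (z * x) (z * y) = dist x y.
Proof. by rewrite /dist invgM -mulgA mulKg. Qed.

Lemma dist_pseudometric : pseudometric dist.
Proof.
have refl x : dist x x = 0%N.
  apply/eqP; rewrite -leqn0; apply/dist_leP; exists 0%R.
  by rewrite mulg1; split; exact: prefix_refl.
have half x y : (dist y x <= dist x y)%N.
  have /dist_leP[k [xy yx]] := leqnn (dist x y).
  apply/dist_leP; exists (- (k + dist x y))%R; split.
    by rewrite -(prefix_mulD (k + dist x y)%R) -mulgA -expgzD addNr mulg1.
  by rewrite -(prefix_mulD k) -mulgA -expgzD opprD addrNK addNr mulg1.
split=> // [x y|x y z]; first by apply/eqP; rewrite eqn_leq !half.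
have /dist_leP[k [xy yx]] := leqnn (dist x y).
have /dist_leP[l [yz zy]] := leqnn (dist y z).
apply/dist_leP; exists (k + l)%R; split.
  by apply: prefix_trans yz; rewrite expgzD mulgA prefix_mulD.
apply: (prefix_trans zy).
have -> : (k + l + (dist x y + dist y z)%N = (k + dist x y) + (l + dist y z))%R by lia.
by rewrite [in D (k + _ + _)%R]expgzD mulgA prefix_mulD.
Qed.

Lemma dist_eq0 x y : dist x y = 0%N <-> exists k, y = x * D k.
Proof.
split=> [d0|[k ->]].
  have /dist_leP[k [xy yx]] : (dist x y <= 0)%N by rewrite d0.
  exists k; apply: lo_antisym (garside_prefix HG) _ _ _ xy.
  by rewrite addr0 in yx.
apply/eqP; rewrite -leqn0; apply/dist_leP; exists k.
by rewrite addr0; split; exact: prefix_refl.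
Qed.

(** The path is x (h /\ Delta^i), where h = x^-1 y Delta^-c and c is the
    infimum of x^-1 y.  Consecutive meets differ by at most one simple factor,
    and h /\ Delta^i reaches h after sup(h) = d(x, y) steps. *)
Lemma garside_path x y : exists w, convex_path dist x y w /\
  (ginf Gp Delta (x^-1 * y)%g = 0%R -> forall i, x <<= w i /\ w i <<= y).
Proof.
pose c := ginf Gp Delta (x^-1 * y)%g.
have [w meet_w] := choice (fun n : nat =>
  lo_meet (garside_prefix HG) (y * D (- c)%R) (x * D n)).
have w_y (n : nat) : w n <<= y * D (- c)%R by have [] := meet_w n.
have w_x (n : nat) : w n <<= x * D n by have [] := meet_w n.
have w_max (n : nat) z : z <<= y * D (- c)%R -> z <<= x * D n -> z <<= w n.
  by have [_ _] := meet_w n; apply.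
have x_y : x <<= y * D (- c)%R.
  have /(prefix_mulD (- c)%R)/(prefix_mul2l x) := (ginfP c (x^-1 * y)).2 (lexx _).
  by rewrite -expgzD subrr mulg1 !mulgA mulgV mul1g.
have x_w (n : nat) : x <<= w n by apply: w_max => //; exact: prefix_mulDr.
exists w; split; last first.
  by move=> c0 i; split=> //; have := w_y i; rewrite /c c0 oppr0 mulg1.
have wS i j : (i <= j)%N -> (dist (w i) (w j) <= j - i)%N.
  move=> ij; apply/dist_leP; exists 0%R; rewrite mulg1 add0r; split.
    apply: w_max => //; apply: (prefix_trans (w_x i)).
    by apply/prefix_mul2l/prefix_D; lia.
  rewrite -(prefix_mulD (- (j - i)%N%:Z)%R) -mulgA -expgzD subrr mulg1.
  apply: w_max.
    apply: prefix_trans (w_y j).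
    by rewrite -(prefix_mulD (j - i)%N%:Z) -mulgA -expgzD addNr mulg1; exact: prefix_mulDr.
  have := w_x j; rewrite -(prefix_mulD (- (j - i)%N%:Z)%R (w j)) -[x * _ * _]mulgA -expgzD.
  by have -> : (j%:Z - (j - i)%N%:Z)%R = i by lia.
split.
- apply/dist_eq0; exists 0%R; rewrite mulg1.
  apply: (lo_antisym (garside_prefix HG)) => //.
  by have := w_x 0%N; rewrite mulg1.
- apply/dist_eq0; exists c.
  rewrite (_ : w _ = y * D (- c)%R) -?mulgA -?expgzD ?addNr ?mulg1 //.
  apply: (lo_antisym (garside_prefix HG)) => //; apply: w_max.
    exact: prefix_refl.
  pose t := gsup Gp Delta (x^-1 * y)%g.
  have /(prefix_mulD (- c)%R)/(prefix_mul2l x) := (gsupP t (x^-1 * y)).2 (lexx _).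
  have -> : D (dist x y) = D (t - c)%R.
    congr expgz; rewrite /dist -/c -/t; have := ginf_le_gsup (x^-1 * y)%g.
    by rewrite -/c -/t; lia.
  by rewrite -expgzD !mulgA mulgV mul1g.
- move=> i j; have [ij|/ltnW ji] := leqP i j; first by have := wS i j ij; lia.
  by have := wS j i ji; rewrite (pm_sym dist_pseudometric); lia.
move=> p r /dist_leP[a [pa ap]] /dist_leP[b [pb bp]] i; apply/dist_leP.
(* Both x Delta^i and y Delta^-c lie in translates of the interval of length r
   above p; so does their meet, in the lower one of the two translates. *)
have px : p * D (a + i)%R <<= x * D i by rewrite expgzD mulgA prefix_mulD.
have xp : x * D i <<= p * D (a + i + r)%R.
  have -> : (a + i + r = a + r + i)%R by lia.
  by rewrite [in D (a + _ + _)%R]expgzD mulgA prefix_mulD.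
have py : p * D (b - c)%R <<= y * D (- c)%R by rewrite expgzD mulgA prefix_mulD.
have yp : y * D (- c)%R <<= p * D (b - c + r)%R.
  have -> : (b - c + r = b + r - c)%R by lia.
  by rewrite [in D (b + _ + _)%R]expgzD mulgA prefix_mulD.
have [ab|/ltW ba] := leP (a + i)%R (b - c)%R.
  exists (a + i)%R; split; last exact: prefix_trans (w_x i) xp.
  by apply: w_max => //; apply: prefix_trans py; apply/prefix_mul2l/prefix_D.
exists (b - c)%R; split; last exact: prefix_trans (w_y i) yp.
by apply: w_max => //; apply: prefix_trans px; apply/prefix_mul2l/prefix_D.
Qed.

(** * Finiteness modulo the centre *)

Hypothesis Hfin : finite_type Gp Delta.

Lemma simple_conj x (n : nat) :
  simples Gp Delta x -> simples Gp Delta (Delta ^- n * x * Delta ^+ n).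
Proof.
move=> sx; elim: n => [|n IHn]; first by rewrite invg1 mul1g mulg1.
have := simple_complement (simple_complement IHn).
by rewrite !invgM !invgK expgSr invgM !mulgA.
Qed.

(** Conjugation by Delta acts on the finite set of simple elements. *)
Lemma simple_commutes_power x : simples Gp Delta x ->
  exists2 n, (0 < n)%N & commute x (Delta ^+ n).
Proof.
move=> sx; have [i [j [ij eq_ij]]] := finite_set_repetition Hfin (fun n => simple_conj n sx).
exists (j - i)%N; first by lia.
have /= := congr1 (fun y => Delta ^+ i * y * Delta ^- i) eq_ij.
have -> : Delta ^+ j = Delta ^+ (j - i) * Delta ^+ i.
  by rewrite -expgnDr subnK // ltnW.
rewrite invgM !mulgA !mulgK mulgV !mul1g => /(congr1 (fun y => Delta ^+ (j - i) * y)).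
by rewrite !mulgA mulgV mul1g.
Qed.

Lemma central_power : exists2 e : nat, (0 < e)%N & center (Delta ^+ e).
Proof.
have [s sA] := (finite_seqP _).1 Hfin.
have [e e0 es] : exists2 e, (0 < e)%N & forall x, x \in s -> commute x (Delta ^+ e).
  have: forall x, x \in s -> exists2 n, (0 < n)%N & commute x (Delta ^+ n).
    by move=> x xs; apply: simple_commutes_power; rewrite sA.
  elim: s {sA} => [|x s IHs] comm_s; first by exists 1%N.
  have [|e e0 es] := IHs; first by move=> y ys; apply: comm_s; rewrite inE ys orbT.
  have [n n0 xn] := comm_s x (mem_head _ _).
  exists (e * n)%N; first by rewrite muln_gt0 e0.
  move=> y; rewrite inE => /orP[/eqP->|/es ye].
    by rewrite mulnC expgnA; exact: commuteX.
  by rewrite expgnA; exact: commuteX.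
exists e => // x; apply: esym; move: x.
suff: [set: G] `<=` [set x | commute x (Delta ^+ e)] by move=> H x; exact: (H x I).
rewrite -(garside_gen_group HG); apply: smallest_sub.
  split; [split|] => /=.
  - exact/commute_sym/commute1.
  - by move=> x y cx cy; apply/commute_sym/commuteM; exact/commute_sym.
  - by move=> x cx; apply/commute_sym/commuteV; exact/commute_sym.
by move=> x sx; apply: es; move: sx; rewrite sA.
Qed.

(** The meet of x with Delta^n splits off a prefix of length at most n and leaves a
    simple element. *)
Lemma finite_interval (n : nat) : finite_set [set x | Gp x /\ x <<= D n].
Proof.
elim: n => [|n IHn].
  apply: sub_finite_set (finite_set1 1) => x [px].
  rewrite /prefix_le mulg1 => px'; exact: garside_antisym HG x px px'.
apply: sub_finite_set (finite_image2 (fun x y => x * y) IHn Hfin).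
move=> x [px xD].
have [m [mx mD max_m]] := lo_meet (garside_prefix HG) x (D n).
have one_le z : Gp z <-> 1 <<= z by rewrite /prefix_le invg1 mul1g.
exists m.
  split=> //; apply/one_le/max_m; first exact: (one_le _).1.
  exact/(one_le _).1/pos_D.
exists (m^-1 * x); last by rewrite mulVKg.
split=> //; apply/(prefix_mul2l m); rewrite mulVKg.
apply/(prefix_mulD (- 1)%R); rewrite -[Delta in m * Delta]/(D 1) -mulgA -expgzD mulg1.
apply: max_m.
  by apply/(prefix_mulD 1%R); rewrite -mulgA -expgzD mulg1; exact: prefix_mulDr.
move/(prefix_mulD (- 1)%R): xD; rewrite -expgzD.
by have -> : (n.+1%:Z + - 1 = n%:Z)%R by lia.
Qed.

(** Up to the central factor (Delta^e)^q, such an h is k f Delta^i k^-1 with f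
    in a finite interval and 0 <= i < e. *)
Lemma finite_moving_little (k : G) (r : nat) :
  finite_set [set coset_class (@center G) h | h in [set h | (dist k (h * k) <= r)%N]].
Proof.
have [e e0 ce] := central_power.
apply: sub_finite_set (finite_image2
  (fun f n => coset_class (@center G) (k * f * D (Posz n) * k^-1))
  (finite_interval r) (finite_II e)) => _ [h /dist_leP[j [kh hk]] <-].
exists (k^-1 * h * k * D (- j)%R).
  have jj i : k * D i * D (- j)%R = k * D (i - j)%R by rewrite -mulgA -expgzD.
  split.
    move/(prefix_mulD (- j)%R): kh; rewrite jj subrr mulg1 /prefix_le.
    by rewrite !mulgA.
  move/(prefix_mulD (- j)%R): hk; rewrite jj.
  have -> : (j + r%:Z - j = r%:Z)%R by lia.
  by move/(prefix_mul2l k^-1); rewrite !mulgA mulVg mul1g.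
exists `|(j %% e)%Z|%N; first by rewrite /=; lia.
rewrite -(@coset_class_mulr _ _ _
    (expgz (Delta ^+ e) (j %/ e)%Z) (@center_subgroup G));
  last exact: expgz_center.
(* Write j = e q + i with 0 <= i < e; the factor Delta^(e q) is central. *)
have qe : D (- j)%R * D `|(j %% e)%Z|%N * D ((j %/ e)%Z * e)%R = 1.
  rewrite -!expgzD (_ : (_ + _)%R = 0%R) //.
  by have := divz_eq j e; lia.
have cz : k^-1 * D ((j %/ e)%Z * e)%R = D ((j %/ e)%Z * e)%R * k^-1.
  by rewrite -expgz_expgn; apply/esym; exact: expgz_center.
congr coset_class; rewrite expgz_expgn -[LHS]mulgA cz.
transitivity (h * k * (D (- j)%R * D `|(j %% e)%Z|%N * D ((j %/ e)%Z * e)%R) * k^-1).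
  by rewrite !mulgA mulgV mul1g.
by rewrite qe mulg1 mulgK.
Qed.

(** * The graphs on cosets *)

Lemma sval_vert x y : sval (@vert G Delta x) y <-> exists k, y = x * D k.
Proof.
split=> [[_ [k _ <-] <-]|[k ->]]; first by exists k.
by exists (D k) => //; exists k.
Qed.

Local Notation V := (@vert G Delta).
Local Notation edgeX := (@edge_X G Gp Delta).
Local Notation edgeAL := (@edge_AL G Gp Delta).

Lemma vert_eq x y : V x = V y <-> dist x y = 0%N.
Proof.
rewrite dist_eq0 -sval_vert; split=> [->|].
  by apply/sval_vert; exists 0%R; rewrite mulg1.
move=> /sval_vert[k ->]; apply: esym; apply: coset_class_mulr.
  exact: cyclic_subgroupP.
by exists k.
Qed.

Lemma vert_surj (v : vertex Delta) : exists x, v = V x.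
Proof.
case: v => A pA; have [x _ xA] := set_mem pA.
by exists x; apply: eq_exist; rewrite xA.
Qed.

Lemma vert_of_sval (v : vertex Delta) x : sval v x -> v = V x.
Proof.
by have [y ->] := vert_surj v; move/sval_vert/dist_eq0/vert_eq.
Qed.

Lemma dist_mulr_D x y k l : dist (x * D k) (y * D l) = dist x y.
Proof.
have pm := dist_pseudometric.
have e z m : dist z (z * D m) = 0%N by apply/dist_eq0; exists m.
have := e x k; have := e y l.
have := pm_triangle pm (x * D k) x (y * D l).
have := pm_triangle pm x y (y * D l).
have := pm_triangle pm x (x * D k) y.
have := pm_triangle pm (x * D k) (y * D l) y.
by rewrite (pm_sym pm (x * D k) x) (pm_sym pm (y * D l) y); lia.
Qed.

Lemma edge_X_dist x y : edgeX (V x) (V y) -> (dist x y <= 1)%N.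
Proof.
move=> [g [s [/vert_eq/dist_eq0[k ->] [ps sD] _ _ /sval_vert[l]]]].
rewrite /underl; set m := (- _)%R => ys.
rewrite -(dist_mulr_D x y (k + m)%R l) -ys expgzD mulgA.
rewrite -[X in dist X _]mulg1 dist_mull; apply/dist_leP.
by exists 0%R; rewrite mulg1 mul1g; split=> //; rewrite /prefix_le invg1 mul1g.
Qed.

Lemma dist1_edge_X x y : dist x y = 1%N -> edgeX (V x) (V y).
Proof.
move=> xy; have /dist_leP[k [xky yxk]] : (dist x y <= 1)%N by rewrite xy.
pose U := underl Gp Delta x; pose m := (- ginf Gp Delta x)%R.
have UE : U = x * D m by [].
pose s := U^-1 * (y * D (m - k)%R).
have Us : U * s = y * D (m - k)%R by rewrite /s mulVKg.
exists x, s; split=> //; last first.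
- by apply/sval_vert; exists (m - k)%R.
- move=> sD; move: xy; rewrite -(dist_mulr_D x y (m + 1)%R (m - k)%R) -Us UE sD.
  by rewrite expgzD1 mulgA (pm_refl dist_pseudometric).
- move=> s1; move: xy; rewrite -(dist_mulr_D x y m (m - k)%R) -Us s1 mulg1 UE.
  by rewrite (pm_refl dist_pseudometric).
split.
  rewrite /s -[Gp _]/(U <<= y * D (m - k)%R) UE.
  move/(prefix_mulD (m - k)%R): xky; rewrite -mulgA -expgzD.
  by have -> : (k + (m - k) = m)%R by lia.
apply/(prefix_mul2l U); rewrite Us UE -mulgA -expgzD1.
move/(prefix_mulD (m - k)%R): yxk; rewrite -mulgA -expgzD.
by have -> : (k + 1%N%:Z + (m - k) = m + 1)%R by lia.
Qed.

Lemma walk_X_dist n x y : walk edgeX n (V x) (V y) -> (dist x y <= n)%N.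
Proof.
elim: n x => [|n IHn] x /=; first by move/vert_eq->.
move=> [v [xv vy]]; have [z vz] := vert_surj v; rewrite vz in xv vy.
have := pm_triangle dist_pseudometric x z y; have := IHn z vy.
case: xv => /edge_X_dist; last rewrite (pm_sym dist_pseudometric); lia.
Qed.

Lemma dist_walk_X x y : walk edgeX (dist x y) (V x) (V y).
Proof.
have pm := dist_pseudometric; have [w [cw _]] := garside_path x y.
have -> : V x = V (w 0%N) by apply/vert_eq; rewrite (pm_sym pm); exact: cp_start cw.
have -> : V y = V (w (dist x y)).
  by apply/vert_eq; rewrite (pm_sym pm); exact: cp_end cw.
apply: (walk_of_path (f := V \o w)) => i ltin; apply: dist1_edge_X.
by rewrite (cp_iso pm cw); lia.
Qed.

Lemma ginf_inv g : ginf Gp Delta g^-1 = (- gsup Gp Delta g)%R.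
Proof.
apply/eqP; rewrite eq_le; apply/andP; split.
  rewrite lerNr; apply/gsupP.
  by have /inv_le_D := (ginfP _ g^-1).2 (lexx _); rewrite invgK.
by apply/ginfP/D_le_inv/gsupP.
Qed.

(** Along a path of prefixes of u^-1 v, the elements a u^-1 (w j) lie between a
    and a u^-1 v, whose infima and suprema agree. *)
Lemma absorber_sphere u v a : ginf Gp Delta (u^-1 * v)%g = 0%R ->
  ginf Gp Delta a = ginf Gp Delta (a * (u^-1 * v))%g ->
  gsup Gp Delta a = gsup Gp Delta (a * (u^-1 * v))%g ->
  exists p rho w, convex_path dist u v w /\ forall j, dist p (w j) = rho.
Proof.
move=> uv0 inf_a sup_a; have [w [cw between]] := garside_path u v.
exists (u * a^-1), (dist 1 a), w; split=> // j.
have [uw wv] := between uv0 j; rewrite /dist.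
have -> : (u * a^-1)^-1 * w j = a * u^-1 * w j by rewrite invgM invgK.
have -> : 1^-1 * a = a by rewrite invg1 mul1g.
have aw : a <<= a * u^-1 * w j by rewrite -{1}(mulgVK u a); apply/prefix_mul2l.
have wa : a * u^-1 * w j <<= a * (u^-1 * v) by rewrite mulgA; apply/prefix_mul2l.
have := ginf_mono aw; have := ginf_mono wa.
by have := gsup_mono aw; have := gsup_mono wa; lia.
Qed.

(** When sup(s) = 0, the inverse of s is positive with infimum 0 and is
    absorbed by a s, so the path is traversed from u s to u. *)
Lemma absorbable_sphere u s : absorbable Gp Delta s ->
  exists p rho w, (convex_path dist u (u * s) w \/ convex_path dist (u * s) u w) /\
    forall j, dist p (w j) = rho.
Proof.
move=> [[s0|s0] [a [inf_a sup_a]]].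
  have [|||p [rho [w [cw pw]]]] := @absorber_sphere u (u * s) a;
    rewrite ?mulKg //.
  by exists p, rho, w; split=> //; left.
have [|||p [rho [w [cw pw]]]] := @absorber_sphere (u * s) u (a * s);
  rewrite ?invgM ?mulgVK ?mulgK //.
- by rewrite ginf_inv s0 oppr0.
by exists p, rho, w; split=> //; right.
Qed.

Lemma exists_convex_path x y : exists w, convex_path dist x y w.
Proof. by have [w [cw _]] := garside_path x y; exists w. Qed.

(** * Axes in the additional length graph *)

Section AxisInAdditionalLengthGraph.
Variables (gamma : int -> G) (L M : nat).
Hypothesis gamma_qi : discrete_qi dist gamma L.
Hypothesis gamma_morse : discrete_morse dist gamma M.

Let pm := dist_pseudometric.
Definition AL_step := (proj_step M + sphere_gap L M)%N.

(** This is where absorbable elements enter: the edges of X move projections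
    by [proj_step], the additional edges by [sphere_gap]. *)
Lemma nearest_edge_AL x y k l : edgeAL (V x) (V y) ->
  nearest dist gamma k x -> nearest dist gamma l y ->
  (dist (gamma k) (gamma l) <= AL_step)%N.
Proof.
rewrite /AL_step => -[/edge_X_dist xy|].
  move=> nk nl.
  have := nearest_step pm exists_convex_path gamma_morse nk nl xy; lia.
move=> [g [s [/vert_eq xg abs_s /vert_of_sval/vert_eq ys]]].
set u := underl Gp Delta g in ys *.
have xu : dist x u = 0%N.
  apply/eqP; rewrite -leqn0 -xg /u /underl -{1}(mulg1 x) -[1]/(D 0%R).
  by rewrite dist_mulr_D.
move=> /(nearest_ext pm xu) nk /(nearest_ext pm ys) nl.
have [p [rho [w [[cw|cw] pw]]]] := absorbable_sphere u abs_s.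
  have := sphere_projection pm exists_convex_path gamma_qi gamma_morse cw
    (fun j _ => pw j) nk nl; lia.
have := sphere_projection pm exists_convex_path gamma_qi gamma_morse cw
  (fun j _ => pw j) nl nk; rewrite (pm_sym pm); lia.
Qed.

Lemma nearest_walk_AL n x y k l : walk edgeAL n (V x) (V y) ->
  nearest dist gamma k x -> nearest dist gamma l y ->
  (dist (gamma k) (gamma l) <= n * AL_step + 3 * proj_gap M)%N.
Proof.
elim: n x k => [|n IHn] x k /=.
  move=> /vert_eq xy nk nl; rewrite mul0n.
  have nk' := nearest_ext pm xy nk.
  exact: (nearest_coarsely_unique pm exists_convex_path gamma_morse nk' nl).
move=> [v [xv vy]] nk nl; have [z vz] := vert_surj v; rewrite vz in xv vy.
have [m nm] := exists_nearest dist gamma z.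
have := IHn z m vy nm nl; have := pm_triangle pm (gamma k) (gamma m) (gamma l).
have : (dist (gamma k) (gamma m) <= AL_step)%N.
  case: xv => /nearest_edge_AL; first exact.
  by rewrite (pm_sym pm); exact.
by rewrite mulSn; lia.
Qed.

End AxisInAdditionalLengthGraph.

Section TranslationAxis.
Variables (g : G) (L M : nat).
Let gamma := expgz g.
Hypothesis gamma_qi : discrete_qi dist gamma L.
Hypothesis gamma_morse : discrete_morse dist gamma M.
Let pm := dist_pseudometric.

Lemma nearest_translate n k x :
  nearest dist gamma k x -> nearest dist gamma (n%:Z + k)%R (g ^+ n * x).
Proof.
move=> nk l; rewrite /gamma expgzD dist_mull.
have -> : l = (n%:Z + (l - n%:Z))%R by lia.
by rewrite [expgz g (n%:Z + _)%R]expgzD dist_mull; exact: nk.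
Qed.

Lemma nearest_axis k : nearest dist gamma k (gamma k).
Proof. by move=> l; rewrite (pm_refl pm). Qed.

Lemma axis_walk_AL n k l : walk edgeAL n (V (gamma k)) (V (gamma l)) ->
  (`|k - l|%N <= L * (n * AL_step L M + 3 * proj_gap M) + L)%N.
Proof.
move=> kl; have [+ _] := gamma_qi k l; move/leq_trans; apply.
rewrite leq_add2r leq_mul2l; apply/orP; right.
exact: (nearest_walk_AL gamma_qi gamma_morse kl (nearest_axis k) (nearest_axis l)).
Qed.

(** N is chosen so that the projections of k and g^n k stay farther apart than
    the error [2 * A + 3 * proj_gap M] which the two displacements allow; then
    the projections of h k and h g^n k violate the conclusion of
    [strongly_contracting], so its hypothesis fails. *)
Lemma coarse_wpd (k : G) (kappa : nat) : exists N : nat, (0 < N)%N /\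
  forall n, (N <= n)%N -> exists B : nat, forall h,
    (exists2 m, (m <= kappa)%N & walk edgeAL m (V k) (V (h * k))) ->
    (exists2 m, (m <= kappa)%N &
       walk edgeAL m (V (g ^+ n * k)) (V (h * (g ^+ n * k)))) ->
    (dist k (h * k) <= B)%N.
Proof.
have [k0 nk0] := exists_nearest dist gamma k.
pose A := (kappa * AL_step L M + 3 * proj_gap M)%N.
exists (L * (2 * A + 3 * proj_gap M + 1) + L).+1; split=> // n Nn.
pose T := dist k (g ^+ n * k).
exists (T + A + dist k (gamma k0))%N => h [m1 m1k walk1] [m2 m2k walk2].
have [a na] := exists_nearest dist gamma (h * k).
have [b nb] := exists_nearest dist gamma (h * (g ^+ n * k)).
have le_A m : (m <= kappa)%N -> (m * AL_step L M + 3 * proj_gap M <= A)%N.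
  by move=> mk; rewrite leq_add2r leq_mul2r mk orbT.
have d1 := leq_trans (nearest_walk_AL gamma_qi gamma_morse walk1 nk0 na) (le_A _ m1k).
have d2 := leq_trans (nearest_walk_AL gamma_qi gamma_morse walk2
  (nearest_translate n nk0) nb) (le_A _ m2k).
have far : (2 * A + 3 * proj_gap M < dist (gamma k0) (gamma (n%:Z + k0)%R))%N.
  rewrite ltnNge; apply/negP => le_A3.
  have [+ _] := gamma_qi k0 (n%:Z + k0)%R.
  have -> : `|(k0 - (Posz n + k0))%R|%N = n by lia.
  move=> nL; have : (L * dist (gamma k0) (gamma (n%:Z + k0)%R) <=
    L * (2 * A + 3 * proj_gap M + 1))%N by rewrite leq_mul2l; apply/orP; right; lia.
  lia.
have : (dist (h * k) (gamma a) < T)%N.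
  rewrite ltnNge; apply/negP => close.
  have := strongly_contracting pm exists_convex_path gamma_morse na nb.
  rewrite dist_mull => /(_ close).
  have := pm_triangle pm (gamma k0) (gamma a) (gamma (n%:Z + k0)%R).
  have := pm_triangle pm (gamma a) (gamma b) (gamma (n%:Z + k0)%R).
  by rewrite (pm_sym pm (gamma b)); lia.
have := pm_triangle pm k (gamma k0) (h * k).
have := pm_triangle pm (gamma k0) (gamma a) (h * k).
by rewrite (pm_sym pm (gamma a)); lia.
Qed.

End TranslationAxis.

(** * From real to integer constants *)

Section RealValues.
Variable R : realType.

Lemma dist_XE x y : dist_X Gp R (V x) (V y) = ((dist x y)%:R%:E)%E.
Proof.
apply/eqP; rewrite eq_le; apply/andP; split.
  exact/graph_dist_le/dist_walk_X.
by apply: graph_dist_ge => n /walk_X_dist; rewrite ler_nat.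
Qed.

Lemma discrete_qi_of_real g : qi_embedding (dist_X Gp R) (fun k => V (expgz g k)) ->
  exists L, discrete_qi dist (expgz g) L.
Proof.
move=> [L [K [L1 K0 LK]]].
(* A common integer bound for both real constants. *)
pose N := (Num.truncn L + Num.truncn K).+1.
have LN : (L <= N%:R)%R.
  apply/ltW/(lt_le_trans (Num.Theory.truncnS_gt L)).
  by rewrite ler_nat ltnS leq_addr.
have KN : (K <= N%:R)%R.
  apply/ltW/(lt_le_trans (Num.Theory.truncnS_gt K)).
  by rewrite ler_nat ltnS leq_addl.
exists (N * N + N)%N => i j; have := LK i j; rewrite /qi_bounds dist_XE !lee_fin.
rewrite -natr_absz; set r := `|(i - j)%R|%N; set d := dist _ _ => -[lo hi].
have N0 : (0 <= N%:R :> R)%R by exact: ler0n.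
have lo' : (r%:R <= L * (d%:R + K))%R.
  by rewrite mulrC -ler_pdivrMr ?(lt_le_trans ltr01) // -lerBlDr.
have dN : (0 <= d%:R :> R)%R by exact: ler0n.
have rN : (0 <= r%:R :> R)%R by exact: ler0n.
have lo2 : (r%:R <= N%:R * (d%:R + N%:R) :> R)%R.
  apply: (le_trans lo'); apply: ler_pM => //; lra.
have hi2 : (d%:R <= N%:R * r%:R + N%:R :> R)%R.
  apply: (le_trans hi); apply: lerD => //; exact: ler_wpM2r.
rewrite -!natrD -!natrM -?natrD !ler_nat in lo2 hi2.
by split; nia.
Qed.

(** A path with integer parameter is extended to a real interval by rounding
    down, which costs an additive constant 1. *)
Lemma discrete_morse_of_real g : morse_element Gp Delta R g ->
  exists M, discrete_morse dist (expgz g) M.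
Proof.
move=> [_ /(_ (4%:R)%R 1%R)] [||M0 hM]; [by rewrite ler1n|by []|].
exists (Num.truncn M0) => n q a b q_qi qa qb i ltin.
pose f (t : R) := V (q (Num.truncn t)).
have [||||k] := hM 0%R (n%:R)%R f _ _ _ (i%:R)%R.
- split=> // s t.
  wlog st : s t / (s <= t)%R => [H|].
    have [st|/ltW ts] := leP s t; first exact: H.
    move=> hs ht; have := H _ _ ts ht hs.
    by rewrite /qi_bounds !dist_XE (pm_sym dist_pseudometric) distrC.
  move=> /andP[s0 sn] /andP[t0 tn].
  have := Num.Theory.truncn_itv s0; have := Num.Theory.truncn_itv t0.
  rewrite /qi_bounds dist_XE.
  set i1 := Num.truncn s; set j1 := Num.truncn t => /andP[jt tj] /andP[is_ si].
  have i1n : (i1 <= n)%N by rewrite -(ler_nat R); apply: le_trans sn.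
  have j1n : (j1 <= n)%N by rewrite -(ler_nat R); apply: le_trans tn.
  have ij1 : (i1 <= j1)%N by apply: Num.Theory.le_truncn.
  have [lo hi] := q_qi i1 j1 i1n j1n.
  have {}lo : (j1 <= i1 + 4 * dist (q i1) (q j1))%N by lia.
  have {}hi : (dist (q i1) (q j1) + i1 <= j1)%N by lia.
  rewrite -(ler_nat R) natrD natrM in lo; rewrite -(ler_nat R) natrD in hi.
  rewrite -!natr1 in tj si.
  rewrite !lee_fin distrC ger0_norm ?subr_ge0 //; split; lra.
- exists a => //; apply/vert_eq; rewrite (pm_sym dist_pseudometric).
  by rewrite Num.Theory.truncn0.
- exists b => //; apply/vert_eq; rewrite (pm_sym dist_pseudometric).
  by rewrite Num.Theory.natrK.
- by rewrite ler0n ler_nat.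
rewrite /f Num.Theory.natrK dist_XE lee_fin => dM; exists k.
by rewrite -ltnS -(ltr_nat R); apply: le_lt_trans dM (Num.Theory.truncnS_gt _).
Qed.

Lemma loxodromic_of_discrete g L M :
  discrete_qi dist (expgz g) L -> discrete_morse dist (expgz g) M ->
  loxodromic Gp Delta R g.
Proof.
move=> gamma_qi gamma_morse.
pose A := (L * AL_step L M + L + 1)%N; pose B := (L * (3 * proj_gap M) + L)%N.
have A1 : (1 <= A%:R :> R)%R by rewrite ler1n /A addn1.
exists (A%:R)%R, (B%:R)%R; split=> // i j.
rewrite /qi_bounds -natr_absz; set r := `|(i - j)%R|%N; split.
  apply: graph_dist_ge => n /(axis_walk_AL gamma_qi gamma_morse); rewrite -/r => rn.
  rewrite lerBlDr ler_pdivrMr ?(lt_le_trans ltr01) //.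
  by rewrite -natrD -natrM ler_nat /A /B; nia.
have [_ hi] := gamma_qi i j; rewrite -/r in hi.
apply: (@le_trans _ _ ((dist (expgz g i) (expgz g j))%:R%:E)%E).
  apply: graph_dist_le; apply: walk_mono (dist_walk_X _ _).
  by move=> u v uv; left.
by rewrite lee_fin -natrM -natrD ler_nat /A /B; nia.
Qed.

Lemma wpd_of_discrete g L M :
  discrete_qi dist (expgz g) L -> discrete_morse dist (expgz g) M ->
  wpd Gp Delta R g.
Proof.
move=> gamma_qi gamma_morse k kappa _.
have [N [N0 HN]] := coarse_wpd gamma_qi gamma_morse k (Num.truncn kappa).
exists N; split=> // n Nn; have [B HB] := HN n Nn.
apply: sub_finite_set (finite_moving_little k B) => _ [h [d1 d2] <-].
by exists h => //=; apply: HB; exact: walk_of_graph_dist.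
Qed.

Lemma loxodromic_diameter g : loxodromic Gp Delta R g ->
  diameter (@dist_AL G Gp Delta R) = (+oo)%E.
Proof.
move=> [L [K [L1 K0 LK]]]; apply/eqyP => A A0.
have L0 : (0 < L)%R := lt_le_trans ltr01 L1.
pose n := (Num.truncn (L * (A + K))%R).+1.
apply: (@le_trans _ _ (dist_AL Gp R (V (expgz g n)) (V (expgz g 0%R)))).
  have [+ _] := LK n 0%R; apply: le_trans.
  rewrite lee_fin subr0 lerBrDr ler_pdivlMr // mulrC.
  exact/ltW/Num.Theory.truncnS_gt.
by apply: ereal_sup_ubound; exists (V (expgz g n), V (expgz g 0%R)).
Qed.

End RealValues.

End GarsideOrder.

(** * Morse elements *)

(** If Delta is trivial then so is the group, and a single point contains no
    quasi-isometrically embedded line. *)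
Lemma morse_Delta_neq1 (R : realType) (G : groupType) (Gp : set G) (Delta g : G) :
  garside Gp Delta -> morse_element Gp Delta R g -> Delta <> 1%g.
Proof.
move=> HG [[L [K [L1 K0 LK]]] _] D1.
have triv (x : G) : x = 1%g.
  suff: ([set: G] `<=` [set 1%g])%classic by move=> H; exact: (H x I).
  rewrite -(garside_gen_group HG); apply: smallest_sub.
    split; [split|] => /=; first by [].
      by move=> x' y -> ->; rewrite mul1g.
    by move=> x' ->; rewrite invg1.
  move=> y [py]; rewrite /prefix_le D1 mulg1 => py'.
  exact: (garside_antisym HG).
have L0 : (0 < L)%R := lt_le_trans ltr01 L1.
pose n := (Num.truncn (L * K)%R).+1.
have [+ _] := LK n 0%R.
rewrite (triv (expgz g n)) (triv (expgz g 0%R)) => /le_trans.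
move=> /(_ _ (@graph_dist_le R _ (@edge_X G Gp Delta) 0%N _ _ erefl)).
rewrite lee_fin subr0 lerBlDr add0r ler_pdivrMr // mulrC leNgt => /negP; apply.
exact: Num.Theory.truncnS_gt.
Qed.

Theorem proposition1p6 (R : realType) (G : groupType) (Gp : set G) (Delta : G)
    (HG : garside Gp Delta) (Hfin : finite_type Gp Delta)
    (Hpure : Delta_pure Gp) :
  (forall g : G, morse_element Gp Delta R g ->
     loxodromic Gp Delta R g /\ wpd Gp Delta R g) /\
  ((exists g : G, morse_element Gp Delta R g) ->
     diameter (@dist_AL G Gp Delta R) = (+oo)%E).
Proof.
have main (g : G) : morse_element Gp Delta R g ->
     loxodromic Gp Delta R g /\ wpd Gp Delta R g.
  move=> mg; have D1 := morse_Delta_neq1 HG mg.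
  have [L gamma_qi] := discrete_qi_of_real HG D1 mg.1.
  have [M gamma_morse] := discrete_morse_of_real HG D1 mg.
  split; first exact: loxodromic_of_discrete gamma_qi gamma_morse.
  exact: wpd_of_discrete gamma_qi gamma_morse.
split=> // -[g /main[lox _]]; exact: loxodromic_diameter lox.
Qed.
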